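(* For every Turing machine $\mathcal{T}$, the variety $\mathcal{V}(\mathbb{A}(\mathcal{T}))$ generated by the algebra $\mathbb{A}(\mathcal{T})$ does not have definable principal subcongruences (DPSC).
   Context: **Turing machines.** A Turing machine $\mathcal{T}$ is a finite list of 5-tuples $(s,r,w,d,t)$, called instructions (read: ''if in state $s$ and reading $r$, write $w$, move direction $d$, enter state $t$''), with a finite set of states $\{\mu_0,\ldots,\mu_m\}$ ($\mu_1$ initial, $\mu_0$ halting), $r,w\in\{0,1\}$, $d\in\{\text{L},\text{R}\}$. **The algebra $\mathbb{A}(\mathcal{T})$.** Let $U=\{1,2,\text{H}\}$, $W=\{C,D,\partial C,\partial D\}$, $A=\{0\}\cup U\cup W$; $V_{ir}^s=\{C_{ir}^s,D_{ir}^s,M_i^r,\partial C_{ir}^s,\partial D_{ir}^s,\partial M_i^r\}$ for $0\le i\le m$, $r,s\in\{0,1\}$; $V_{ir}=V_{ir}^0\cup V_{ir}^1$, $V_i=V_{i0}\cup V_{i1}$, $V=\bigcup_{0\le i\le m}V_i$. All displayed symbols are distinct. The universe is $A(\mathcal{T})=A\cup V$. Here $\partial$ is a permutation of order 2 with domain $V\cup W$ ($\partial\partial x=x$); it is not an operation of the algebra, and a condition such as $x=\partial y$ holds only for $y\in V\cup W$. The fundamental operations are as follows. The constant $0$. Meet: $x\wedge y=x$ if $x=y$, and $0$ otherwise (a height 1 semilattice with bottom $0$; below $\vee$ denotes join in the associated order, $x\le y$ iff $x\in\{0,y\}$). Multiplication: $2\cdot D=\text{H}\cdot C=D$, $1\cdot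 C=C$, $2\cdot\partial D=\text{H}\cdot\partial C=\partial D$, $1\cdot\partial C=\partial C$, and $x\cdot y=0$ otherwise. $J(x,y,z)=x$ if $x=y$; $=x\wedge z$ if $x=\partial y$; $=0$ otherwise. $J'(x,y,z)=x\wedge z$ if $x=y$; $=x$ if $x=\partial y$; $=0$ otherwise. $S_0(u,x,y,z)=(x\wedge y)\vee(x\wedge z)$ if $u\in V_0$, and $0$ otherwise. $S_1(u,x,y,z)=(x\wedge y)\vee(x\wedge z)$ if $u\in\{1,2\}$, and $0$ otherwise. $S_2(u,v,x,y,z)=(x\wedge y)\vee(x\wedge z)$ if $u=\partial v\in V\cup W$, and $0$ otherwise. $T(w,x,y,z)=w\cdot x$ if $w\cdot x=y\cdot z$ and $(w,x)=(y,z)$; $=\partial(w\cdot x)$ if $w\cdot x=y\cdot z\ne0$ and $(w,x)\ne(y,z)$; $=0$ otherwise. $I(1)=C_{10}^0$, $I(\text{H})=M_1^0$, $I(2)=D_{10}^0$, and $I(x)=0$ otherwise. For each instruction $(\mu_i,r,s,\text{L},\mu_j)$ of $\mathcal{T}$ and each $t\in\{0,1\}$, an operation $L_{irt}(x,y,u)$ equal to: $C_{jt}^{s'}$ if $x=y=1$ and $u=C_{ir}^{s'}$ for some $s'$; $M_j^t$ if $x=\text{H}$, $y=1$, $u=C_{ir}^t$; $D_{jt}^s$ if $x=2$, $y=\text{H}$, $u=M_i^r$; $D_{jt}^{s'}$ if $x=y=2$ and $u=D_{ir}^{s'}$ for some $s'$; $\partial v$ if $u\in V$ and $L_{irt}(x,y,\partial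 u)=v\in V$ by the preceding clauses; $0$ otherwise. $\mathcal{L}$ is the set of these operations. For each instruction $(\mu_i,r,s,\text{R},\mu_j)$ and each $t\in\{0,1\}$, an operation $R_{irt}(x,y,u)$ equal to: $C_{jt}^{s'}$ if $x=y=1$ and $u=C_{ir}^{s'}$ for some $s'$; $C_{jt}^s$ if $x=\text{H}$, $y=1$, $u=M_i^r$; $M_j^t$ if $x=2$, $y=\text{H}$, $u=D_{ir}^t$; $D_{jt}^{s'}$ if $x=y=2$ and $u=D_{ir}^{s'}$ for some $s'$; $\partial v$ if $u\in V$ and $R_{irt}(x,y,\partial u)=v\in V$ by the preceding clauses; $0$ otherwise. $\mathcal{R}$ is the set of these operations. Define $\prec$ on $\{1,2,\text{H}\}$ by $2\prec2$, $2\prec\text{H}$, $\text{H}\prec1$, $1\prec1$ (and no other pairs). For each $F\in\mathcal{L}\cup\mathcal{R}$: $U_F^1(x,y,z,u)=\partial F(x,y,u)$ if $x\prec z$, $y\ne z$, $F(x,y,u)\ne0$; $=F(x,y,u)$ if $x\prec z$, $y=z$, $F(x,y,u)\ne0$; $=0$ otherwise. $U_F^0(x,y,z,u)=\partial F(y,z,u)$ if $x\prec z$, $x\ne y$, $F(y,z,u)\ne0$; $=F(y,z,u)$ if $x\prec z$, $x=y$, $F(y,z,u)\ne0$; $=0$ otherwise. The operations of $\mathbb{A}(\mathcal{T})$ are $\{0,\wedge,(\cdot),J,J',S_0,S_1,S_2,T,I\}\cup\mathcal{L}\cup\mathcal{R}\cup\{U_F^1,U_F^0\mid F\in\mathcal{L}\cup\mathcal{R}\}$.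 **DPSC.** $\text{Cg}^{\mathbb{B}}(a,b)$ denotes the principal congruence of $\mathbb{B}$ generated by $(a,b)$. A congruence formula for a class $\mathcal{C}$ of algebras of the same type is a 4-ary first order formula $\psi(w,x,y,z)$ such that for all $\mathbb{B}\in\mathcal{C}$ and $a,b,c,d\in B$, if $\mathbb{B}\models\psi(c,d,a,b)$ then $(c,d)\in\text{Cg}^{\mathbb{B}}(a,b)$. We say $\psi(-,-,a,b)$ defines $\text{Cg}^{\mathbb{B}}(a,b)$ if for all $c,d\in B$: $\mathbb{B}\models\psi(c,d,a,b)$ iff $(c,d)\in\text{Cg}^{\mathbb{B}}(a,b)$. A class $\mathcal{C}$ of algebras of the same type has definable principal subcongruences (DPSC) if there are congruence formulas $\Gamma$ and $\psi$ for $\mathcal{C}$ such that for every $\mathbb{B}\in\mathcal{C}$ and every $a,b\in B$ with $a\ne b$ there exist $c,d\in B$ with $c\neq d$ such that $\mathbb{B}\models\Gamma(c,d,a,b)$ and $\psi(-,-,c,d)$ defines $\text{Cg}^{\mathbb{B}}(c,d)$. *)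

(* Defs.v *)
From HB Require Import structures.
From mathcomp Require Import all_boot.

Set Implicit Arguments.
Unset Strict Implicit.
Unset Printing Implicit Defensive.

(** * Universal algebra *)

Record signature := Signature { op : Type; arity : op -> nat }.

Record algebra (S : signature) := Algebra {
  carrier :> Type;
  interp : forall f : op S, ('I_(arity f) -> carrier) -> carrier
}.

Definition is_hom (S : signature) (A B : algebra S) (h : A -> B) : Prop :=
  forall (f : op S) (v : 'I_(arity f) -> A),
    h (interp v) = interp (fun i => h (v i)).

Definition product (S : signature) (I : Type) (A : I -> algebra S) :
    algebra S :=
  @Algebra S (forall i, A i) (fun f v i => interp (fun k => v k i)).

(* Subalgebras and homomorphic images are taken up to isomorphism. *)
Definition closed_H (S : signature) (K : algebra S -> Prop) : Prop :=
  forall (A B : algebra S) (h : A -> B),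
    is_hom h -> (forall y, exists x, h x = y) -> K A -> K B.

Definition closed_S (S : signature) (K : algebra S -> Prop) : Prop :=
  forall (A B : algebra S) (h : B -> A),
    is_hom h -> injective h -> K A -> K B.

Definition closed_P (S : signature) (K : algebra S -> Prop) : Prop :=
  forall (I : Type) (A : I -> algebra S), (forall i, K (A i)) -> K (product A).

Definition is_variety (S : signature) (K : algebra S -> Prop) : Prop :=
  [/\ closed_H K, closed_S K & closed_P K].

Definition variety_generated_by (S : signature) (A : algebra S) :
    algebra S -> Prop :=
  fun B => forall K : algebra S -> Prop, is_variety K -> K A -> K B.

Record is_congruence (S : signature) (A : algebra S) (E : A -> A -> Prop) :
    Prop := IsCongruence {
  congruence_refl : forall x, E x x;
  congruence_sym : forall x y, E x y -> E y x;
  congruence_trans : forall x y z, E x y -> E y z -> E x z;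
  congruence_op : forall (f : op S) (v w : 'I_(arity f) -> A),
    (forall i, E (v i) (w i)) -> E (interp v) (interp w)
}.

(* [Cg a b c d] means that (c, d) belongs to Cg(a, b). *)
Definition Cg (S : signature) (A : algebra S) (a b c d : A) : Prop :=
  forall E : A -> A -> Prop, is_congruence E -> E a b -> E c d.

(** * First-order logic with equality

    [form S n] is the type of formulas with free variables among the n
    variables indexed by 'I_n; under a quantifier the bound variable has
    index 0 and the index of every other variable is shifted by one. *)

Inductive term (S : signature) (n : nat) : Type :=
| Var of 'I_n
| App (f : op S) of ('I_(arity f) -> term S n).

Inductive form (S : signature) : nat -> Type :=
| FEq n of term S n & term S n : form S n
| FNot n of form S n : form S n
| FAnd n of form S n & form S n : form S n
| FOr n of form S n & form S n : form S n
| FImp n of form S n & form S n : form S n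
| FAll n of form S n.+1 : form S n
| FEx n of form S n.+1 : form S n.

Fixpoint eval (S : signature) (A : algebra S) n (v : 'I_n -> A)
    (t : term S n) : A :=
  match t with
  | Var i => v i
  | App f ts => interp (fun k => eval v (ts k))
  end.

Definition env_cons (A : Type) n (x : A) (v : 'I_n -> A) : 'I_n.+1 -> A :=
  fun i => if unlift ord0 i is Some j then v j else x.

Fixpoint sat (S : signature) (A : algebra S) n (p : form S n) :
    ('I_n -> A) -> Prop :=
  match p in form _ n return ('I_n -> A) -> Prop with
  | FEq _ s t => fun v => eval v s = eval v t
  | FNot _ p => fun v => ~ sat p v
  | FAnd _ p q => fun v => sat p v /\ sat q v
  | FOr _ p q => fun v => sat p v \/ sat q v
  | FImp _ p q => fun v => sat p v -> sat q v
  | FAll _ p => fun v => forall x : A, sat p (env_cons x v)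
  | FEx _ p => fun v => exists x : A, sat p (env_cons x v)
  end.

Definition sat4 (S : signature) (A : algebra S) (p : form S 4) (w x y z : A) :
    Prop :=
  sat p (tnth [tuple w; x; y; z]).

(** * Definable principal subcongruences *)

Definition congruence_formula (S : signature) (K : algebra S -> Prop)
    (p : form S 4) : Prop :=
  forall B : algebra S, K B ->
  forall a b c d : B, sat4 p c d a b -> Cg a b c d.

Definition defines_Cg (S : signature) (B : algebra S) (p : form S 4)
    (a b : B) : Prop :=
  forall c d : B, sat4 p c d a b <-> Cg a b c d.

Definition has_DPSC (S : signature) (K : algebra S -> Prop) : Prop :=
  exists Gamma psi : form S 4,
    [/\ congruence_formula K Gamma, congruence_formula K psi &
     forall B : algebra S, K B -> forall a b : B, a <> b ->
     exists c d : B, [/\ c <> d, sat4 Gamma c d a b & defines_Cg psi c d]].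

(** * Turing machines *)

Inductive direction := DirL | DirR.

Definition bool_of_direction d := if d is DirL then true else false.
Definition direction_of_bool b := if b then DirL else DirR.
Lemma bool_of_directionK : cancel bool_of_direction direction_of_bool.
Proof. by case. Qed.
HB.instance Definition _ := Finite.copy direction (can_type bool_of_directionK).

(* The states mu_0, ..., mu_m include both mu_0 and mu_1, so m >= 1 and the
   set of states is 'I_k.+2 with k = m - 1. The tape symbols 0 and 1 are
   [false] and [true]. *)
Definition instruction (k : nat) : Type :=
  ('I_k.+2 * bool * bool * direction * 'I_k.+2)%type.

Record turing_machine := TuringMachine {
  nb_states_sub2 : nat;
  instructions : seq (instruction nb_states_sub2)
}.

Definition state (T : turing_machine) : Type := 'I_(nb_states_sub2 T).+2.

Definition mu1 (T : turing_machine) : state T := lift ord0 ord0.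

(** * The algebra A(T) *)

(* The members of V and W that are not in the range of the symbol ∂:
   C, D, C_{ir}^s, D_{ir}^s and M_i^r, the last three being written
   [VC i r s], [VD i r s] and [VM i r]. *)
Inductive base (T : turing_machine) : Type :=
| WC
| WD
| VC of state T & bool & bool
| VD of state T & bool & bool
| VM of state T & bool.

Arguments WC {T}.
Arguments WD {T}.

(* [Plain b] is b and [Barred b] is ∂b. *)
Inductive elt (T : turing_machine) : Type :=
| Zero
| One
| Two
| Hd
| Plain of base T
| Barred of base T.

Arguments Zero {T}.
Arguments One {T}.
Arguments Two {T}.
Arguments Hd {T}.

Section Encoding.
Variable T : turing_machine.

Definition base_code : Type :=
  (bool + ('I_(nb_states_sub2 T).+2 * bool * bool * bool)
        + ('I_(nb_states_sub2 T).+2 * bool))%type.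

Definition base_encode (b : base T) : base_code :=
  match b with
  | WC => inl (inl true)
  | WD => inl (inl false)
  | VC i r s => inl (inr (i, r, s, true))
  | VD i r s => inl (inr (i, r, s, false))
  | VM i r => inr (i, r)
  end.

Definition base_decode (c : base_code) : base T :=
  match c with
  | inl (inl true) => WC
  | inl (inl false) => WD
  | inl (inr (i, r, s, true)) => VC i r s
  | inl (inr (i, r, s, false)) => VD i r s
  | inr (i, r) => VM i r
  end.

Lemma base_encodeK : cancel base_encode base_decode.
Proof. by case. Qed.

HB.instance Definition _ := Finite.copy (base T) (can_type base_encodeK).

Definition elt_encode (x : elt T) : 'I_4 + (base T + base T) :=
  match x with
  | Zero => inl (@Ordinal 4 0 isT)
  | One => inl (@Ordinal 4 1 isT)
  | Two => inl (@Ordinal 4 2 isT)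
  | Hd => inl (@Ordinal 4 3 isT)
  | Plain b => inr (inl b)
  | Barred b => inr (inr b)
  end.

Definition elt_decode (c : 'I_4 + (base T + base T)) : elt T :=
  match c with
  | inl i => nth Zero [:: Zero; One; Two; Hd] i
  | inr (inl b) => Plain b
  | inr (inr b) => Barred b
  end.

Lemma elt_encodeK : cancel elt_encode elt_decode.
Proof. by case. Qed.

HB.instance Definition _ := Finite.copy (elt T) (can_type elt_encodeK).

End Encoding.

Section Operations.
Variable T : turing_machine.
Implicit Types u v w x y z : elt T.

Definition base_state (b : base T) : option (state T) :=
  match b with
  | WC | WD => None
  | VC i _ _ | VD i _ _ | VM i _ => Some i
  end.

Definition elt_state x : option (state T) :=
  match x with
  | Plain b | Barred b => base_state b
  | _ => None
  end.

Definition inVW x : bool :=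
  match x with
  | Plain _ | Barred _ => true
  | _ => false
  end.

Definition inV x : bool := elt_state x.

Definition inV0 x : bool := elt_state x == Some ord0.

(* The values of [bar] outside of V and W are irrelevant. *)
Definition bar x : elt T :=
  match x with
  | Plain b => Barred b
  | Barred b => Plain b
  | _ => x
  end.

(* x = ∂y *)
Definition is_bar x y : bool := inVW y && (x == bar y).

Definition meet x y : elt T := if x == y then x else Zero.

(* The join in the height 1 semilattice; it is only used for x and y that
   have a common upper bound, i.e. x = y or one of them is 0. *)
Definition join x y : elt T := if x == Zero then y else x.

Definition mul x y : elt T :=
  match x, y with
  | Two, Plain WD | Hd, Plain WC => Plain WD
  | One, Plain WC => Plain WC
  | Two, Barred WD | Hd, Barred WC => Barred WD
  | One, Barred WC => Barred WC
  | _, _ => Zero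
  end.

Definition opJ x y z : elt T :=
  if x == y then x else if is_bar x y then meet x z else Zero.

Definition opJ' x y z : elt T :=
  if x == y then meet x z else if is_bar x y then x else Zero.

Definition opS0 u x y z : elt T :=
  if inV0 u then join (meet x y) (meet x z) else Zero.

Definition opS1 u x y z : elt T :=
  if (u == One) || (u == Two) then join (meet x y) (meet x z) else Zero.

Definition opS2 u v x y z : elt T :=
  if is_bar u v then join (meet x y) (meet x z) else Zero.

Definition opT w x y z : elt T :=
  if mul w x == mul y z then
    if (w == y) && (x == z) then mul w x
    else if mul w x != Zero then bar (mul w x) else Zero
  else Zero.

Definition opI x : elt T :=
  match x with
  | One => Plain (VC (mu1 T) false false)
  | Hd => Plain (VM (mu1 T) false)
  | Two => Plain (VD (mu1 T) false false)
  | _ => Zero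
  end.

(* The clauses of L_{irt} and R_{irt} other than the one about ∂. *)
Definition stepL (i : state T) (r s : bool) (j : state T) (t : bool)
    x y u : elt T :=
  match x, y, u with
  | One, One, Plain (VC i' r' s') =>
      if (i' == i) && (r' == r) then Plain (VC j t s') else Zero
  | Hd, One, Plain (VC i' r' s') =>
      if [&& i' == i, r' == r & s' == t] then Plain (VM j t) else Zero
  | Two, Hd, Plain (VM i' r') =>
      if (i' == i) && (r' == r) then Plain (VD j t s) else Zero
  | Two, Two, Plain (VD i' r' s') =>
      if (i' == i) && (r' == r) then Plain (VD j t s') else Zero
  | _, _, _ => Zero
  end.

Definition stepR (i : state T) (r s : bool) (j : state T) (t : bool)
    x y u : elt T :=
  match x, y, u with
  | One, One, Plain (VC i' r' s') =>
      if (i' == i) && (r' == r) then Plain (VC j t s') else Zero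
  | Hd, One, Plain (VM i' r') =>
      if (i' == i) && (r' == r) then Plain (VC j t s) else Zero
  | Two, Hd, Plain (VD i' r' s') =>
      if [&& i' == i, r' == r & s' == t] then Plain (VM j t) else Zero
  | Two, Two, Plain (VD i' r' s') =>
      if (i' == i) && (r' == r) then Plain (VD j t s') else Zero
  | _, _, _ => Zero
  end.

Definition close_bar (F : elt T -> elt T -> elt T -> elt T) x y u : elt T :=
  if F x y u != Zero then F x y u
  else if inV u && inV (F x y (bar u)) then bar (F x y (bar u))
  else Zero.

Definition opLR (q : instruction (nb_states_sub2 T)) (t : bool) :
    elt T -> elt T -> elt T -> elt T :=
  let: (i, r, s, d, j) := q in
  close_bar (match d with
             | DirL => stepL i r s j t
             | DirR => stepR i r s j t
             end).

Definition prec x y : bool :=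
  match x, y with
  | Two, Two | Two, Hd | Hd, One | One, One => true
  | _, _ => false
  end.

Definition opU1 (F : elt T -> elt T -> elt T -> elt T) x y z u : elt T :=
  if prec x z && (F x y u != Zero) then
    if y == z then F x y u else bar (F x y u)
  else Zero.

Definition opU0 (F : elt T -> elt T -> elt T -> elt T) x y z u : elt T :=
  if prec x z && (F y z u != Zero) then
    if x == y then F y z u else bar (F y z u)
  else Zero.

End Operations.

(* [OLR q t] is L_{irt} or R_{irt}, according to the direction of the
   instruction q = (mu_i, r, s, d, mu_j). *)
Inductive opsym (T : turing_machine) : Type :=
| OZero
| OMeet
| OMul
| OJ
| OJ'
| OS0
| OS1
| OS2
| OT
| OI
| OLR of {q | q \in instructions T} & bool
| OU1 of {q | q \in instructions T} & bool
| OU0 of {q | q \in instructions T} & bool.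

Definition opsym_arity (T : turing_machine) (f : opsym T) : nat :=
  match f with
  | OZero => 0
  | OI => 1
  | OMeet | OMul => 2
  | OJ | OJ' | OLR _ _ => 3
  | OS0 | OS1 | OT | OU1 _ _ | OU0 _ _ => 4
  | OS2 => 5
  end.

Definition AT_signature (T : turing_machine) : signature :=
  Signature (@opsym_arity T).

Fixpoint nary (A : Type) (n : nat) : Type :=
  if n is n'.+1 then A -> nary A n' else A.

Fixpoint apply_nary (A : Type) (n : nat) : nary A n -> ('I_n -> A) -> A :=
  match n return nary A n -> ('I_n -> A) -> A with
  | 0 => fun c _ => c
  | n'.+1 => fun g v => apply_nary (g (v ord0)) (fun i => v (lift ord0 i))
  end.

Definition AT_op (T : turing_machine) (f : opsym T) :
    nary (elt T) (opsym_arity f) :=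
  match f return nary (elt T) (opsym_arity f) with
  | OZero => Zero
  | OMeet => @meet T
  | OMul => @mul T
  | OJ => @opJ T
  | OJ' => @opJ' T
  | OS0 => @opS0 T
  | OS1 => @opS1 T
  | OS2 => @opS2 T
  | OT => @opT T
  | OI => @opI T
  | OLR q t => opLR (val q) t
  | OU1 q t => opU1 (opLR (val q) t)
  | OU0 q t => opU0 (opLR (val q) t)
  end.

Definition AT (T : turing_machine) : algebra (AT_signature T) :=
  @Algebra (AT_signature T) (elt T) (fun f => apply_nary (AT_op f)).

(* Main.v *)
(** The witnessing algebra [BT T] uses only 0, C, D and ∂D, on which every
    operation other than the meet, J, J' and S_2 vanishes.  It consists of
    functions on two copies of the naturals.  On the first copy an element is
    periodic; on the second it may equal the n-th guard, and then it is barred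
    on at most one residue class modulo n+1 of the first copy.  A congruence
    Cg(a, 0), with a constantly D on the first copy and 0 on the second, leaves
    the second copy alone, so a nontrivial pair (c, d) of it differs on some
    residue class modulo p.  As J(x, y, z) can open a gap in x only where
    x = ∂y, an element with n-th guard, n+1 = pN, loses that class under
    Cg(c, d) only through N successive steps of one residue class modulo n+1
    each.  A formula defining Cg(c, d) would hold for all these pairs, hence,
    by the theorem of Łoś, in an ultrapower for a pair at infinite distance. *)

Require Import Defs.
From mathcomp Require Import all_boot.
From mathcomp Require Import boolp classical_sets filter.

Set Implicit Arguments.
Unset Strict Implicit.
Unset Printing Implicit Defensive.

(** * Generated varieties and evaluation of terms *)

Lemma variety_generated_by_gen (S : signature) (A : algebra S) :
  variety_generated_by A A.
Proof. by []. Qed.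

Lemma variety_generated_by_is_variety (S : signature) (A : algebra S) :
  is_variety (variety_generated_by A).
Proof.
split.
- move=> B C h hh hs VB K KV KA; case: (KV) => KH _ _.
  exact: (KH _ _ h hh hs (VB K KV KA)).
- move=> B C h hh hi VB K KV KA; case: (KV) => _ KS _.
  exact: (KS _ _ h hh hi (VB K KV KA)).
- move=> I B VB K KV KA; case: (KV) => _ _ KP.
  by apply: KP => i; exact: VB.
Qed.

Lemma env_cons_comp (A B : Type) (f : A -> B) (n : nat) (x : A)
    (v : 'I_n -> A) :
  env_cons (f x) (fun i => f (v i)) = fun i => f (env_cons x v i).
Proof. by apply: funext => i; rewrite /env_cons; case: unlift. Qed.

Lemma eval_hom (S : signature) (A B : algebra S) (h : A -> B) (n : nat)
    (v : 'I_n -> A) (t : term S n) :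
  is_hom h -> h (eval v t) = eval (fun i => h (v i)) t.
Proof.
move=> hh; elim: t => [//|f ts IH] /=; rewrite hh; congr interp.
by apply: funext => k; exact: IH.
Qed.

Lemma eval_power (S : signature) (I : Type) (A : algebra S) (n : nat)
    (v : 'I_n -> product (fun _ : I => A)) (t : term S n) (i : I) :
  eval v t i = eval (fun k => v k i) t.
Proof.
elim: t => [//|f ts IH] /=; congr interp.
by apply: funext => k; exact: IH.
Qed.

(** * Ultrapowers, the theorem of Łoś, and congruence formulas in ultrapowers *)

Lemma ultra_not (I : Type) (U : set_system I) (P : I -> Prop) :
  UltraFilter U -> U (fun i => ~ P i) <-> ~ U P.
Proof.
move=> UU; have FU : ProperFilter U by exact: ultra_proper.
split=> [UnP UP|nUP].
  have [i [ni pi]] := filter_ex (filterI UnP UP).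
  exact: ni pi.
by case: (in_ultra_setVsetC P UU).
Qed.

(* The ultrapower is given by a surjective homomorphism [h] from the power
   whose kernel is equality almost everywhere. *)
Lemma Los (S : signature) (I : Type) (U : set_system I) (A Q : algebra S)
    (h : product (fun _ : I => A) -> Q) (n : nat) (p : form S n)
    (v : 'I_n -> product (fun _ : I => A)) :
  UltraFilter U -> is_hom h -> (forall q, exists x, h x = q) ->
  (forall x y, h x = h y <-> U (fun i => x i = y i)) ->
  sat p (fun k => h (v k)) <-> U (fun i => sat p (fun k => v k i)).
Proof.
move=> UU hh hs hU; have FU : ProperFilter U by exact: ultra_proper.
have eachE n' (x : product (fun _ : I => A))
    (w : 'I_n' -> product (fun _ : I => A)) i :
    env_cons (x i) (fun k => w k i) = fun k => env_cons x w k i.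
  exact: (env_cons_comp (fun y : product (fun _ : I => A) => y i)).
elim: p v => {n} /=.
- move=> n s t v; rewrite -!(eval_hom _ _ hh) hU.
  by split; apply: filterS => i; rewrite !eval_power.
- by move=> n p IH v; rewrite IH ultra_not.
- move=> n p IHp q IHq v; rewrite IHp IHq; split=> [[]|Upq].
    exact: filterI.
  by split; apply: filterS Upq => i [].
- move=> n p IHp q IHq v; rewrite IHp IHq; split=> [[]|Upq].
  + by apply: filterS => i; left.
  + by apply: filterS => i; right.
  apply: contrapT => /not_orP; rewrite -!ultra_not // => -[np nq].
  by have [i [[npi nqi] []]] := filter_ex (filterI (filterI np nq) Upq).
- move=> n p IHp q IHq v; rewrite IHp IHq; split=> [pq|Upq].
    case: (pselect (U (fun i => sat p (fun k => v k i)))) => [/pq|].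
      by apply: filterS => i.
    by rewrite -ultra_not //; apply: filterS.
  by move=> Up; apply: filterS (filterI Upq Up) => i []; apply.
- move=> n p IH v; split=> [all_p|Up q].
    apply: contrapT; rewrite -ultra_not // => Unp.
    have [i0 /existsNP[x0 _]] := filter_ex Unp.
    (* Choose a counterexample at each index that has one, with [x0] as the default at the
       others. *)
    have /choice[x xP] : forall i, exists x,
        ~ (forall y, sat p (env_cons y (fun k => v k i))) ->
        ~ sat p (env_cons x (fun k => v k i)).
      move=> i; case: (pselect (forall y, sat p (env_cons y (fun k => v k i)))).
        by exists x0.
      by move=> /existsNP[y yP]; exists y.
    have := all_p (h x); rewrite env_cons_comp IH.
    apply/ultra_not; apply: filterS Unp => i /xP.
    by rewrite eachE.
  have [x <-] := hs q; rewrite env_cons_comp IH.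
  by apply: filterS Up => i /(_ (x i)); rewrite eachE.
- move=> n p IH v; split=> [[q]|Up].
    have [x <-] := hs q; rewrite env_cons_comp IH.
    by apply: filterS => i xP; exists (x i); rewrite eachE.
  have [i0 [x0 _]] := filter_ex Up.
  have /choice[x xP] : forall i, exists x,
      (exists y, sat p (env_cons y (fun k => v k i))) ->
      sat p (env_cons x (fun k => v k i)).
    move=> i; case: (pselect (exists y, sat p (env_cons y (fun k => v k i)))).
      by case=> y yP; exists y.
    by exists x0.
  exists (h x); rewrite env_cons_comp IH; apply: filterS Up => i /xP.
  by rewrite eachE.
Qed.

Lemma sat4_Los (S : signature) (I : Type) (U : set_system I) (A Q : algebra S)
    (h : product (fun _ : I => A) -> Q) (p : form S 4)
    (w x y z : product (fun _ : I => A)) :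
  UltraFilter U -> is_hom h -> (forall q, exists x, h x = q) ->
  (forall x y, h x = h y <-> U (fun i => x i = y i)) ->
  sat4 p (h w) (h x) (h y) (h z) <->
  U (fun i => sat4 p (w i) (x i) (y i) (z i)).
Proof.
move=> UU hh hs hU; rewrite /sat4.
have -> : tnth [tuple h w; h x; h y; h z] =
    fun k => h (tnth [tuple w; x; y; z] k).
  by apply: funext => -[[|[|[|[|]]]]].
rewrite (Los _ _ UU hh hs hU).
suff -> : (fun i => sat p (tnth [tuple w i; x i; y i; z i])) =
    (fun i => sat p (fun k => tnth [tuple w; x; y; z] k i)) by [].
apply: funext => i; congr sat.
by apply: funext => -[[|[|[|[|]]]]].
Qed.

(** Elements are the classes of almost everywhere equality, taken as predicates on the power;
    operations are computed on chosen representatives [r]. *)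
Lemma ultrapower_exists (S : signature) (I : Type) (U : set_system I)
    (A : algebra S) : UltraFilter U ->
  exists (Q : algebra S) (h : product (fun _ : I => A) -> Q),
    [/\ is_hom h, forall q, exists x, h x = q &
        forall x y, h x = h y <-> U (fun i => x i = y i)].
Proof.
move=> UU; have FU : ProperFilter U by exact: ultra_proper.
pose P := product (fun _ : I => A); pose eqU (x y : P) := U (fun i => x i = y i).
have eqUxx x : eqU x x by apply: filterE.
have eqUC x y : eqU x y -> eqU y x by apply: filterS.
have eqUT x y z : eqU x y -> eqU y z -> eqU x z.
  by move=> xy yz; apply: filterS (filterI xy yz) => i [->].
pose Qt := {X : P -> Prop | exists x, X = eqU x}.
pose cl (x : P) : Qt := exist _ (eqU x) (ex_intro _ x erefl).
have clE x y : cl x = cl y <-> eqU x y.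
  split=> [[/(congr1 (fun X => X y))] -> //|xy].
  apply: eq_exist => /=; apply: funext => z; apply/propext.
  by split; apply: eqUT => //; exact: eqUC.
have cls (q : Qt) : exists x, cl x = q.
  by case: q => X [x Xx]; exists x; apply: eq_exist.
have /choice[r rK] := cls.
exists (@Algebra S Qt (fun f v => cl (interp (fun k => r (v k))))), cl; split => //.
move=> f v /=; apply/clE.
(* The arity is finite, so the representatives agree with all the arguments simultaneously almost
   everywhere. *)
have : U (fun i => forall k, v k i = r (cl (v k)) i).
  apply: filter_forall => k; apply/clE; by rewrite rK.
apply: filterS => i vE /=; congr interp; exact: funext.
Qed.

(* The pairs of sequences that are [R k]-related almost everywhere for some
   fixed k form a congruence of the ultrapower. *)
Lemma congruence_formula_bounded (S : signature) (V : algebra S -> Prop)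
    (psi : form S 4) (B : algebra S) (R : nat -> B -> B -> Prop)
    (k0 : nat) (c d : B) (e f : nat -> B) :
  is_variety V -> congruence_formula V psi -> V B ->
  (forall k l x y, k <= l -> R k x y -> R l x y) ->
  (forall x, R 0 x x) ->
  (forall k x y, R k x y -> R k y x) ->
  (forall k l x y z, R k x y -> R l y z -> R (k + l) x z) ->
  (forall (g : op S) k, exists l, forall v w : 'I_(arity g) -> B,
    (forall i, R k (v i) (w i)) -> R l (interp v) (interp w)) ->
  R k0 c d -> (forall n, sat4 psi (e n) (f n) c d) ->
  exists k, forall N, exists n, N <= n /\ R k (e n) (f n).
Proof.
move=> [VH _ VP] psiV VB Rle Rxx RC RT Rop Rcd ef.
(* [U] contains every tail of the naturals, so what holds almost everywhere holds at arbitrarily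
   large indices. *)
have [U [UU oU]] := ultraFilterLemma eventually_filter.
have FU : ProperFilter U by exact: ultra_proper.
have [Q [h [hh hs hU]]] := ultrapower_exists B UU.
have VQ : V Q by apply: (VH _ _ h hh hs); apply: VP.
have psiQ : sat4 psi (h e) (h f) (h (fun=> c)) (h (fun=> d)).
  by apply/(sat4_Los psi e f (fun=> c) (fun=> d) UU hh hs hU); apply: filterE.
(* The bound k does not depend on n, which keeps pairs at unbounded distance out of [E]. *)
pose E q q' := exists k x y, [/\ h x = q, h y = q' & U (fun n => R k (x n) (y n))].
have Eh x y : E (h x) (h y) -> exists k, U (fun n => R k (x n) (y n)).
  move=> [k [x' [y' [/hU xx' /hU yy' xy']]]]; exists k.
  by apply: filterS (filterI (filterI xx' yy') xy') => n [[-> ->]].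
have congE : is_congruence E.
  split.
  - move=> q; have [x <-] := hs q; exists 0, x, x; split=> //.
    exact: filterE.
  - move=> q q' [k [x [y [xq yq xy]]]]; exists k, y, x; split=> //.
    by apply: filterS xy => n; exact: RC.
  - move=> q q' q''; have [x <-] := hs q; have [y <-] := hs q'.
    have [z <-] := hs q'' => /Eh[k xy] /Eh[l yz].
    exists (k + l), x, z; split=> //.
    by apply: filterS (filterI xy yz) => n []; exact: RT.
  - move=> g v w vw.
    have /choice[x xP] : forall i, exists x, h x = v i by move=> i; exact: hs.
    have /choice[y yP] : forall i, exists y, h y = w i by move=> i; exact: hs.
    have /choice[k kP] : forall i, exists k, U (fun n => R k (x i n) (y i n)).
      by move=> i; apply: Eh; rewrite xP yP.
    (* Finitely many arguments have a common bound. *)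
    have [l lP] := Rop g (\max_i k i).
    exists l, (interp x), (interp y); split.
    + by rewrite hh; congr interp; exact: funext.
    + by rewrite hh; congr interp; exact: funext.
    have : U (fun n => forall i, R (k i) (x i n) (y i n)) by exact: filter_forall.
    apply: filterS => n xy /=; apply: lP => i.
    by apply: Rle (xy i); exact: leq_bigmax.
have Ecd : E (h (fun=> c)) (h (fun=> d)).
  by exists k0, (fun=> c), (fun=> d); split=> //; apply: filterE.
have [k ek] := Eh _ _ (psiV Q VQ _ _ _ _ psiQ E congE Ecd).
exists k => N; have UN : U (fun n => N <= n) by apply: oU; exists N.
by have [n [Nn Rn]] := filter_ex (filterI UN ek); exists n.
Qed.

(** * Operations of [AT T] on the values 0, C, D and ∂D *)

Definition inCD (T : turing_machine) : {pred elt T} :=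
  [pred x in [:: Zero; Plain WC; Plain WD; Barred WD]].

Definition zero_on_W (T : turing_machine) (f : opsym T) : bool :=
  match f with OMeet | OJ | OJ' | OS2 => false | _ => true end.

(** Apart from the constant 0, each of these operations needs an argument in U or V_0 for a nonzero
    value. *)
Lemma interp_zero_on_W (T : turing_machine) (f : opsym T)
    (w : 'I_(opsym_arity f) -> elt T) :
  zero_on_W f -> (forall k, w k \in @inCD T) -> @interp _ (AT T) f w = Zero.
Proof.
have bar0 F (x y z : elt T) :
    (forall v, F x y v = Zero) -> close_bar F x y z = Zero.
  by move=> F0; rewrite /close_bar !F0 andbF.
have mul0 x y : x \in @inCD T -> y \in @inCD T -> Defs.mul x y = Zero.
  by rewrite !inE => /or4P[]/eqP-> /or4P[]/eqP->.
case: f w => [||||||||||q t|q t|q t] //= w _ wW.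
- exact: mul0.
- by move: (wW ord0); rewrite !inE => /or4P[]/eqP->.
- by move: (wW ord0); rewrite !inE => /or4P[]/eqP->.
- by rewrite /opT !mul0 // eqxx; case: ifP.
- by move: (wW ord0); rewrite !inE => /or4P[]/eqP->.
- rewrite /opLR; case: (val q) => -[[[i r] s] d] j; apply: bar0 => v.
  by move: (wW ord0); rewrite !inE; case: d => /or4P[]/eqP->.
- by rewrite /opU1; move: (wW ord0); rewrite !inE => /or4P[]/eqP->.
- by rewrite /opU0; move: (wW ord0); rewrite !inE => /or4P[]/eqP->.
Qed.

(** The position [k0] is the same for all [w], so on functions a value lies pointwise below one
    fixed argument and inherits its range and its bars. *)
Lemma interp_W_arg (T : turing_machine) (f : opsym T) :
  zero_on_W f \/
  exists k0, forall w : 'I_(opsym_arity f) -> elt T,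
    @interp _ (AT T) f w = Zero \/ @interp _ (AT T) f w = w k0.
Proof.
case: f; try (by move=> *; left); right.
- by exists ord0 => w; rewrite /= /meet; case: ifP; [right|left].
- exists ord0 => w; rewrite /= /opJ /meet.
  by do !case: ifP => _; auto.
- exists ord0 => w; rewrite /= /opJ' /meet.
  by do !case: ifP => _; auto.
- exists (lift ord0 (lift ord0 ord0)) => w; rewrite /= /opS2 /meet /join.
  by do !case: ifP => _; auto.
Qed.

(* [K] consists of all arguments, except for J, whose third argument matters
   only under a bar. The first clause applies where no argument is barred, and
   the second where those in [K] are not. *)
Lemma interp_determined (T : turing_machine) (f : opsym T) :
  exists K : pred 'I_(opsym_arity f),
    (forall w : 'I_(opsym_arity f) -> elt T,
      (forall k, w k \in [:: Zero; Plain WC; Plain WD]) ->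
      @interp _ (AT T) f w <> Zero ->
      forall k, K k -> w k = @interp _ (AT T) f w) /\
    (forall w w' : 'I_(opsym_arity f) -> elt T,
      (forall k, w k \in [:: Zero; Plain WD; Barred WD]) ->
      (forall k, K k -> w k = w' k /\ w k <> Barred WD) ->
      @interp _ (AT T) f w = @interp _ (AT T) f w').
Proof.
have allK (w w' : 'I_(opsym_arity f) -> elt T) :
    (forall k, xpredT k -> w k = w' k /\ w k <> Barred WD) ->
    @interp _ (AT T) f w = @interp _ (AT T) f w'.
  by move=> ww'; congr interp; apply: funext => k; case: (ww' k).
have unbarred (x y : elt T) : x \in [:: Zero; Plain WC; Plain WD] ->
    y \in [:: Zero; Plain WC; Plain WD] -> is_bar x y = false.
  by rewrite !inE => /or3P[]/eqP-> /or3P[]/eqP->.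
have [f0|nf0] := boolP (zero_on_W f).
  exists predT; split=> [w wY|w w' _]; last exact: allK.
  rewrite interp_zero_on_W // => k; move: (wY k).
  by rewrite !inE => /or3P[]->; rewrite ?orbT.
case: f allK nf0 => // allK _.
- exists predT; split=> [w wY|w w' _]; last exact: allK.
  rewrite /= /meet; case: eqP => // e _ k _.
  by case: (unliftP ord0 k) => [j|] ->; rewrite ?ord1.
- exists [pred k : 'I_3 | k < 2]; split=> [w wY|w w' wX ww'].
    rewrite /= /opJ unbarred //; case: eqP => // e _ k.
    case: (unliftP ord0 k) => [j|] -> //.
    by case: (unliftP ord0 j) => [l|] -> //; rewrite ord1.
  rewrite /= /opJ; have [<- n0] := ww' ord0 isT.
  have [<- n1] := ww' (lift ord0 ord0) isT.
  (* Among 0, D and ∂D only D and ∂D are exchanged by ∂; with neither argument barred, J ignores its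
     third argument. *)
  suff -> : is_bar (w ord0) (w (lift ord0 ord0)) = false by [].
  apply/negP => /andP[]; move: n0 n1 (wX ord0) (wX (lift ord0 ord0)).
  by rewrite !inE => n0 n1 /or3P[]/eqP x /or3P[]/eqP y; move: n0 n1; rewrite x y.
- exists predT; split=> [w wY|w w' _]; last exact: allK.
  rewrite /= /opJ' unbarred // /meet; case: eqP => // e; case: eqP => // e' _ k _.
  case: (unliftP ord0 k) => [j|] -> //.
  by case: (unliftP ord0 j) => [l|] -> //; rewrite ord1.
- exists predT; split=> [w wY|w w' _]; last exact: allK.
  by rewrite /= /opS2 unbarred.
Qed.

(** * The witnessing algebra [BT T] *)

Definition guard (T : turing_machine) (n y : nat) : elt T :=
  if y == n then Plain WD else Plain WC.

Definition guarded (T : turing_machine) (x : nat + nat -> elt T) (n : nat) :=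
  forall y, x (inr y) = guard T n y.

Lemma guard_neq0 (T : turing_machine) (n y : nat) : guard T n y <> Zero.
Proof. by rewrite /guard; case: ifP. Qed.

Lemma guard_inj (T : turing_machine) (x : nat + nat -> elt T) (m n : nat) :
  guarded x m -> guarded x n -> m = n.
Proof.
move=> xm xn; have := xm m; rewrite (xn m) /guard eqxx.
by case: eqP.
Qed.

(** Periodicity spreads a difference at one point over a residue class. The last clause restricts
    only guarded elements; the others may be barred anywhere. *)
Definition inB (T : turing_machine) (x : nat + nat -> elt T) : Prop :=
  [/\ forall j, x (inl j) \in [:: Zero; Plain WD; Barred WD],
      forall y, x (inr y) \in [:: Zero; Plain WC; Plain WD],
      exists p, 0 < p /\ forall j, x (inl j) = x (inl (j %% p)) &
      forall n, guarded x n ->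
        exists r, forall j, x (inl j) = Barred WD -> j %% n.+1 = r].

Lemma inB_inCD (T : turing_machine) (x : nat + nat -> elt T) (i : nat + nat) :
  inB x -> x i \in @inCD T.
Proof.
move=> [xX xY _ _]; case: i => [j|y].
  by move: (xX j); rewrite !inE => /or3P[]->; rewrite ?orbT.
by move: (xY y); rewrite !inE => /or3P[]->; rewrite ?orbT.
Qed.

Lemma inB_interp (T : turing_machine) (f : opsym T)
    (v : 'I_(opsym_arity f) -> nat + nat -> elt T) :
  (forall k, inB (v k)) ->
  inB (fun i => @interp _ (AT T) f (fun k => v k i)).
Proof.
move=> vB; pose w i := @interp _ (AT T) f (fun k => v k i).
have [w0|[k0 wk0]] : (forall i, w i = Zero) \/
    exists k0, forall i, w i = Zero \/ w i = v k0 i.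
  have [f0|[k0 fk]] := interp_W_arg f; [left|right].
    by move=> i; apply: interp_zero_on_W => // k; exact: inB_inCD.
  by exists k0 => i; exact: fk.
- split=> [j|y||n wn]; rewrite -/(w _) ?w0 ?inE //.
    by exists 1; split=> // j; rewrite -!/(w _) !w0.
  by exists 0 => j; rewrite -/(w _) w0.
have [vX vY _ vbar] := vB k0; split.
- by move=> j; rewrite -/(w _); case: (wk0 (inl j)) => ->; [rewrite inE|exact: vX].
- by move=> y; rewrite -/(w _); case: (wk0 (inr y)) => ->; [rewrite inE|exact: vY].
- have /choice[p pP] : forall k, exists p,
      0 < p /\ forall j, v k (inl j) = v k (inl (j %% p)).
    by move=> k; case: (vB k).
  exists (\prod_k p k); split=> [|j].
    by apply: prodn_gt0 => k; case: (pP k).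
  congr (@interp _ (AT T) f _); apply: funext => k; have [_ vp] := pP k.
  rewrite vp [RHS]vp modn_dvdm //.
  by rewrite (bigD1 k) //= dvdn_mulr.
- move=> n wn.
  (* A guarded value is nonzero throughout the second copy, so argument [k0] has the same guard, and
     every bar of the value comes from it. *)
  have [|r rP] := vbar n.
    move=> y; case: (wk0 (inr y)) => wE; last by rewrite -wE; exact: wn.
    by case: (@guard_neq0 T n y); rewrite -wn -[RHS]wE.
  exists r => j wj; apply: rP; case: (wk0 (inl j)) => wE; last by rewrite -wE.
  by move: wE; rewrite /w wj.
Qed.

Definition BT (T : turing_machine) : algebra (AT_signature T) :=
  @Algebra (AT_signature T) {x : nat + nat -> elt T | inB x}
    (fun f v => exist _ _ (inB_interp (fun k => svalP (v k)))).

Lemma BT_ext (T : turing_machine) (x y : BT T) :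
  (forall i, sval x i = sval y i) -> x = y.
Proof.
case: x y => [x xB] [y yB] /= xy; apply: eq_exist; exact: funext.
Qed.

Lemma BT_in_variety (T : turing_machine) :
  variety_generated_by (AT T) (BT T).
Proof.
have [_ VS VP] := variety_generated_by_is_variety (AT T).
apply: (VS (product (fun _ : nat + nat => AT T)) (BT T)
  (fun x : BT T => sval x : product (fun _ : nat + nat => AT T))).
- by [].
- by move=> [x xB] [y yB] /= xy; exact: eq_exist.
- by apply: VP => _; exact: variety_generated_by_gen.
Qed.

(** * Distance between elements, measured at the guards *)

(* [close k] bounds by [k], at each guard, the number of residue classes on
   which two elements differ; it plays the role of the length of a Maltsev
   chain. *)
Definition close (T : turing_machine) (k : nat) (x y : BT T) : Prop :=
  (forall i, sval x (inr i) = sval y (inr i)) /\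
  forall n, guarded (sval x) n -> exists s : seq nat, size s <= k /\
    forall j, sval x (inl j) <> sval y (inl j) -> j %% n.+1 \in s.

(** If the value has guard n, so has each argument in [K]. Such an argument changes on at most k
    classes and is barred on at most one, hence [k.+1]; off all these classes the values agree by
    [interp_determined]. *)
Lemma close_interp (T : turing_machine) (f : opsym T) (k : nat)
    (v w : 'I_(opsym_arity f) -> BT T) :
  (forall i, close k (v i) (w i)) ->
  close (opsym_arity f * k.+1) (@interp _ (BT T) f v) (@interp _ (BT T) f w).
Proof.
move=> vw; split=> [y|n] /=.
  by congr (@interp _ (AT T) f _); apply: funext => i; case: (vw i).
have [K [KY KX]] := interp_determined f => vn.
have vK i : K i -> guarded (sval (v i)) n.
  move=> Ki y; rewrite -(vn y).
  apply: (KY (fun i => sval (v i) (inr y))) => // [l|].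
    by case: (svalP (v l)).
  by rewrite [X in X <> _]vn; exact: guard_neq0.
have /choice[s sP] : forall i, exists s : seq nat, size s <= k.+1 /\
    (K i -> forall j, j %% n.+1 \notin s ->
      sval (v i) (inl j) = sval (w i) (inl j) /\
      sval (v i) (inl j) <> Barred WD).
  move=> i; case: (boolP (K i)) => [Ki|]; last by exists [::].
  have [_ _ _ /(_ n (vK i Ki))[r rP]] := svalP (v i).
  have [_ /(_ n (vK i Ki))[s [sk sP]]] := vw i.
  exists (r :: s); split=> // _ j; rewrite inE negb_or => /andP[jr js]; split.
    by apply: contrapT => /sP; rewrite (negPf js).
  by move=> /rP jE; rewrite jE eqxx in jr.
exists (flatten [seq s i | i <- enum 'I_(opsym_arity f)]); split.
  rewrite size_flatten /shape -map_comp sumnE big_map big_enum /=.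
  rewrite -[X in _ <= X * _]card_ord -sum_nat_const.
  by apply: leq_sum => i _; case: (sP i).
move=> j vwj; apply: contrapT => /negP js; apply: vwj; apply: KX => [i|i Ki].
  by case: (svalP (v i)).
have [_] := sP i; apply => //; apply: contra js => js.
by apply/flattenP; exists (s i) => //; apply: map_f; rewrite mem_enum.
Qed.

Lemma close_le (T : turing_machine) (k l : nat) (x y : BT T) :
  k <= l -> close k x y -> close l x y.
Proof.
move=> kl [xyY xyX]; split=> // n /xyX[s [sk sP]].
by exists s; split=> //; exact: leq_trans kl.
Qed.

Lemma close_refl (T : turing_machine) (x : BT T) : close 0 x x.
Proof. by split=> // n _; exists [::]. Qed.

Lemma close_sym (T : turing_machine) (k : nat) (x y : BT T) :
  close k x y -> close k y x.
Proof.
move=> [xyY xyX]; split=> // n yn.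
have [|s [sk sP]] := xyX n; first by move=> i; rewrite xyY.
by exists s; split=> // j /nesym/sP.
Qed.

Lemma close_trans (T : turing_machine) (k l : nat) (x y z : BT T) :
  close k x y -> close l y z -> close (k + l) x z.
Proof.
move=> [xyY xyX] [yzY yzX]; split=> [i|n xn]; first by rewrite xyY.
have [s [sk sP]] := xyX n xn.
have [|t [tl tP]] := yzX n; first by move=> i; rewrite -xyY.
exists (s ++ t); split=> [|j xz]; first by rewrite size_cat leq_add.
rewrite mem_cat; have [xy|/sP->//] := pselect (sval x (inl j) = sval y (inl j)).
by rewrite tP ?orbT // -xy.
Qed.

(** An element has at most one guard n, and there are only n+1 residue classes to count. *)
Lemma eq_on_guards_close (T : turing_machine) (x y : BT T) :
  (forall i, sval x (inr i) = sval y (inr i)) -> exists k, close k x y.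
Proof.
move=> xyY; have [[n xn]|nx] := pselect (exists n, guarded (sval x) n).
  exists n.+1; split=> // m xm; exists (iota 0 n.+1); rewrite size_iota.
  by split=> // j _; rewrite mem_iota (guard_inj xm xn) ltn_mod.
by exists 0; split=> // n xn; case: nx; exists n.
Qed.

(** * Test elements and the pairs forced into a congruence *)

Definition glue (T : turing_machine) (F G : nat -> elt T) (i : nat + nat) :=
  match i with inl j => F j | inr y => G y end.

Lemma inB_glue0 (T : turing_machine) (F : nat -> elt T) (p : nat) :
  0 < p -> (forall j, F j \in [:: Zero; Plain WD; Barred WD]) ->
  (forall j, F j = F (j %% p)) -> inB (glue F (fun=> Zero)).
Proof.
move=> p0 FX Fp; split=> //; first by exists p.
by move=> n /(_ 0)/esym; case/guard_neq0.
Qed.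

Definition piece (T : turing_machine) (p r : nat) : nat + nat -> elt T :=
  glue (fun j => if j %% p == r then Plain WD else Zero) (fun=> Zero).

Lemma inB_piece (T : turing_machine) (p r : nat) : r < p -> inB (piece T p r).
Proof.
move=> rp; apply: (inB_glue0 (leq_ltn_trans (leq0n r) rp)) => j; first by case: ifP.
by rewrite modn_mod.
Qed.

Definition constB (T : turing_machine) (a : elt T)
    (aX : a \in [:: Zero; Plain WD; Barred WD]) : BT T :=
  exist _ (glue (fun=> a) (fun=> Zero))
    (inB_glue0 (ltn0Sn 0) (fun=> aX) (fun=> erefl)).

Definition zeroB (T : turing_machine) : BT T := @constB T Zero isT.

Definition holed (T : turing_machine) (n : nat) (L : seq nat) :
    nat + nat -> elt T :=
  glue (fun j => if j %% n.+1 \in L then Zero else Plain WD) (guard T n).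

(** A single class of bars is all that [inB] allows at the n-th guard. *)
Definition barred (T : turing_machine) (n r : nat) : nat + nat -> elt T :=
  glue (fun j => if j %% n.+1 == r then Barred WD else Plain WD) (guard T n).

Lemma inB_holed (T : turing_machine) (n : nat) (L : seq nat) :
  inB (holed T n L).
Proof.
split=> [j|y||m _] /=.
- by case: ifP.
- by rewrite /guard; case: ifP.
- by exists n.+1; split=> // j; rewrite modn_mod.
- by exists 0 => j; case: ifP.
Qed.

Lemma inB_barred (T : turing_machine) (n r : nat) : inB (barred T n r).
Proof.
split=> [j|y||m nm] /=.
- by case: ifP.
- by rewrite /guard; case: ifP.
- by exists n.+1; split=> // j; rewrite modn_mod.
have nn : guarded (barred T n r) n by [].
by rewrite (guard_inj nm nn); exists r => j; case: eqP.
Qed.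

Definition holedB (T : turing_machine) (n : nat) (L : seq nat) : BT T :=
  exist _ _ (inB_holed T n L).

(** Let e = c(i) and let P be the piece on the class of i modulo a common period of c and d. The
    polynomial S_2(c ∧ x, ∂e, P, P, P) sends c to P, and sends d to 0 because c ∧ d vanishes on that
    class. *)
Lemma Cg_piece (T : turing_machine) (c d : BT T) (i : nat) :
  sval c (inl i) <> sval d (inl i) -> sval c (inl i) <> Zero ->
  exists p r (rp : r < p), Cg c d (exist _ _ (@inB_piece T p r rp)) (zeroB T).
Proof.
move=> cdi ci.
have [cX _ [p [p0 cp]] _] := svalP c; have [_ _ [q [q0 dq]] _] := svalP d.
have pq0 : i %% (p * q) < p * q by rewrite ltn_mod muln_gt0 p0.
exists (p * q), (i %% (p * q)), pq0 => E congE cd.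
set P := exist _ _ _.
have cE j : j %% (p * q) == i %% (p * q) -> sval c (inl j) = sval c (inl i).
  move=> /eqP ji; rewrite cp [RHS]cp.
  by rewrite -(modn_dvdm j (dvdn_mulr q (dvdnn p))) ji modn_dvdm ?dvdn_mulr.
have dE j : j %% (p * q) == i %% (p * q) -> sval d (inl j) = sval d (inl i).
  move=> /eqP ji; rewrite dq [RHS]dq.
  by rewrite -(modn_dvdm j (dvdn_mull p (dvdnn q))) ji modn_dvdm ?dvdn_mull.
have bX : bar (sval c (inl i)) \in [:: Zero; Plain WD; Barred WD].
  by move: (cX i); rewrite !inE => /or3P[]/eqP->.
pose m (x : BT T) : BT T := @interp _ (BT T) (OMeet T) (tnth [tuple c; x]).
pose s (x : BT T) : BT T := @interp _ (BT T) (OS2 T)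
  (tnth [tuple m x; constB bX; P; P; P]).
have sval_s x k : sval (s x) k = opS2 (meet (sval c k) (sval x k))
    (sval (constB bX) k) (sval P k) (sval P k) (sval P k) by [].
have sE x y : E x y -> E (s x) (s y).
  move=> xy; apply: (congruence_op congE) => k.
  case: (unliftP ord0 k) => [j|] -> /=; last first.
    apply: (congruence_op congE) => l.
    case: (unliftP ord0 l) => [o|] ->; last exact: (congruence_refl congE).
    by rewrite ord1.
  have -> : tnth [tuple m x; constB bX; P; P; P] (lift ord0 j) =
      tnth [tuple m y; constB bX; P; P; P] (lift ord0 j).
    by rewrite !(tnth_nth P) lift0.
  exact: (congruence_refl congE).
have <- : s c = P.
  apply: BT_ext => k; rewrite sval_s.
  case: k => [j|y] /=; last by [].
  rewrite /opS2 /meet !eqxx.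
  have [/cE->|_] := boolP (j %% (p * q) == _); last by case: (is_bar _ _).
    suff -> : is_bar (sval c (inl i)) (bar (sval c (inl i))) by [].
    move: ci (cX i); rewrite !inE => ci /or3P[]/eqP cE'; first by case: ci.
    + by rewrite cE' /is_bar /= eqxx.
    + by rewrite cE' /is_bar /= eqxx.
have <- : s d = zeroB T.
  apply: BT_ext => k; rewrite sval_s.
  case: k => [j|y] /=; last by [].
  rewrite /opS2 /meet !eqxx.
  have [ji|_] := boolP (j %% (p * q) == _); last by case: (is_bar _ _).
  rewrite (cE _ ji) (dE _ ji); case: eqP => // _.
  suff -> : is_bar Zero (bar (sval c (inl i))) = false by [].
  by move: (cX i); rewrite !inE => /or3P[]/eqP ->.
exact: sE.
Qed.

(** The holes are opened one at a time. With h holed on [L] and b barred on the class of q, J(h, b,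
    x) consults x only where h = ∂b, on that class. The class lies inside the piece since p divides
    n+1, so the piece gives h and 0 opens the new hole. *)
Lemma Cg_holed (T : turing_machine) (E : BT T -> BT T -> Prop) (p r n : nat)
    (rp : r < p) (L : seq nat) :
  is_congruence E -> E (exist _ _ (@inB_piece T p r rp)) (zeroB T) ->
  p %| n.+1 -> (forall q, q \in L -> q %% p = r) ->
  E (holedB T n [::]) (holedB T n L).
Proof.
set P := exist _ _ _ => congE EP pn; elim: L => [_|q L IH Lr].
  exact: (congruence_refl congE).
apply: (congruence_trans congE) (IH _) _ => [l lL|].
  by apply: Lr; rewrite inE lL orbT.
pose s (x : BT T) : BT T := @interp _ (BT T) (OJ T)
  (tnth [tuple holedB T n L; exist _ _ (inB_barred T n q); x]).
have sval_s x k : sval (s x) k =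
    opJ (holed T n L k) (barred T n q k) (sval x k) by [].
have sE : E (s P) (s (zeroB T)).
  apply: (congruence_op congE) => k.
  case: (unliftP ord0 k) => [j|] ->; last exact: (congruence_refl congE).
  case: (unliftP ord0 j) => [l|] ->; last exact: (congruence_refl congE).
  by rewrite ord1.
have <- : s P = holedB T n L.
  apply: BT_ext => k; rewrite sval_s.
  case: k => [j|y] /=; rewrite /opJ ?eqxx //.
  have [_|_] := boolP (j %% n.+1 \in L);
    have [/eqP jq|_] := boolP (j %% n.+1 == q) => //.
  rewrite /meet /=; suff -> : j %% p == r by [].
  by rewrite -(modn_dvdm j pn) jq Lr // inE eqxx.
have <- // : s (zeroB T) = holedB T n (q :: L).
apply: BT_ext => k; rewrite sval_s.
case: k => [j|y] /=; rewrite /opJ ?eqxx //.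
rewrite inE; have [_|_] := boolP (j %% n.+1 \in L);
  by have [_|_] := boolP (j %% n.+1 == q).
Qed.

(** * Failure of definable principal subcongruences *)

Theorem theorem3p8 (T : turing_machine) :
  ~ has_DPSC (variety_generated_by (AT T)).
Proof.
move=> [Gamma [psi [GammaV psiV /(_ (BT T) (@BT_in_variety T))]]].
pose a : BT T := @constB T (Plain WD) isT.
have aneq : a <> zeroB T by move=> /(congr1 (fun x => sval x (inl 0))).
move=> /(_ a (zeroB T) aneq)[c [d [cd Gcd psiE]]].
(* Equality on the second copy is a congruence containing (a, 0), hence (c, d). *)
have cdY i : sval c (inr i) = sval d (inr i).
  have := GammaV _ (@BT_in_variety T) _ _ _ _ Gcd.
  move=> /(_ (fun x y => forall i, sval x (inr i) = sval y (inr i))); apply => //.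
  split=> //.
  - by move=> x y z xy yz k; rewrite xy.
  - move=> f v w vw k /=; congr (@interp _ (AT T) f _).
    by apply: funext => l; exact: vw.
have [i cdi] : exists i, sval c (inl i) <> sval d (inl i).
  apply: contrapT => /forallNP cdX; apply: cd.
  by apply: BT_ext => -[j|y]; [apply: contrapT; exact: cdX|exact: cdY].
have [p [r [rp Pcd]]] : exists p r (rp : r < p), Cg c d
    (exist _ _ (@inB_piece T p r rp)) (zeroB T).
  (* [Cg_piece] needs a nonzero value in its first element; c and d are exchanged when c(i) = 0. *)
  have [ci|ci] := pselect (sval c (inl i) = Zero); last exact: (Cg_piece cdi ci).
  have [|p [r [rp Pdc]]] := @Cg_piece T d c i (nesym cdi).
    by move=> di; apply: cdi; rewrite ci.
  exists p, r, rp => E congE Ecd; apply: (Pdc E congE).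
  exact: (congruence_sym congE).
(* With n+1 = p(N+1), the class of r modulo p splits into N+1 classes modulo n+1, represented by
   [holes N]. *)
pose n N := (p * N.+1).-1.
pose holes N := [seq r + p * t | t <- iota 0 N.+1].
have nE N : (n N).+1 = p * N.+1.
  by rewrite prednK // muln_gt0 (leq_ltn_trans _ rp).
have psi_holed N : sat4 psi (holedB T (n N) [::]) (holedB T (n N) (holes N)) c d.
  apply/psiE => E congE Ecd.
  apply: (Cg_holed congE (Pcd E congE Ecd)); first by rewrite nE dvdn_mulr.
  by move=> q /mapP[t _ ->]; rewrite addnC mulnC modnMDl modn_small.
have [k0 ck0] := eq_on_guards_close cdY.
have [k /(_ k)[N [kN [_ /(_ (n N) (fun=> erefl))[s [sk sP]]]]]] :=
  congruence_formula_bounded (variety_generated_by_is_variety (AT T)) psiV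
    (@BT_in_variety T) (@close_le T) (@close_refl T) (@close_sym T)
    (@close_trans T) (fun f k => ex_intro _ _ (@close_interp T f k)) ck0
    psi_holed.
(* The two elements differ on all N+1 classes in [holes N], whereas [s] covers the differences with
   at most k <= N classes. *)
suff : size (holes N) <= size s.
  rewrite size_map size_iota => Ns.
  by have := leq_trans (leq_trans Ns sk) kN; rewrite ltnn.
apply: uniq_leq_size => [|q qN].
  rewrite map_inj_uniq ?iota_uniq // => t u /addnI/eqP.
  by rewrite eqn_pmul2l ?(leq_ltn_trans _ rp) // => /eqP.
have qn : q < (n N).+1.
  case/mapP: qN => t; rewrite mem_iota nE => /andP[_ tN] ->.
  rewrite (@leq_trans (p * t.+1)) ?leq_mul2l ?tN ?orbT //.
  by rewrite mulnS ltn_add2r.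
by rewrite -(modn_small qn); apply: sP => /=; rewrite (modn_small qn) qN.
Qed.
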